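(* Let $d\ge 2$, $k\ge 1$, and let $\alpha_1,\dots,\alpha_k\in\mathbb{C}^n$ satisfy $\langle\alpha_i,\alpha_i\rangle=0$ for all $i$ and be such that $h_{\alpha_1}^d(z),\dots,h_{\alpha_k}^d(z)$ are linearly independent over $\mathbb{C}$. Let $$P(z)=\sum_{i=1}^kh_{\alpha_i}^d(z),\qquad \Psi_P=\left(\langle\alpha_i,\alpha_j\rangle\,h_{\alpha_j}^{d-2}(z)\right)_{1\le i,j\le k}.$$ Then for every $m\ge 1$, $$\operatorname{Tr}\left((\operatorname{Hes}P)^m\right)=(d(d-1))^m\operatorname{Tr}\left(\Psi_P^m\right).$$ In particular, $P(z)$ is Hessian nilpotent if and only if the matrix $\Psi_P$ is nilpotent.
   Context: $z=(z_1,\dots,z_n)$; $\langle\cdot,\cdot\rangle$ is the standard $\mathbb{C}$-bilinear form on $n$-vectors; $h_\alpha(z)=\langle\alpha,z\rangle$ for $\alpha\in\mathbb{C}^n$. $\operatorname{Hes}P=\left(\frac{\partial^2P}{\partial z_i\partial z_j}\right)$ is the Hessian matrix, and $P$ is Hessian nilpotent if $\operatorname{Hes}P$ is nilpotent. *)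

(* Defs.v *)
From mathcomp Require Import all_boot all_order all_algebra.
From mathcomp Require Import reals.
From mathcomp Require Import complex mpoly.

Set Implicit Arguments.
Unset Strict Implicit.
Unset Printing Implicit Defensive.

Import GRing.Theory.
Local Open Scope ring_scope.

(* The C-bilinear pairing: no complex conjugation, unlike [dotmx]. *)
Definition bform (A : comNzRingType) (n : nat) (u v : 'rV[A]_n) : A :=
  \sum_(i < n) u 0 i * v 0 i.

Definition zvec (K : comNzRingType) (n : nat) : 'rV[{mpoly K[n]}]_n :=
  \row_(i < n) 'X_i.

Definition hlin (K : comNzRingType) (n : nat) (a : 'rV[K]_n) : {mpoly K[n]} :=
  bform (map_mx (@mpolyC n K) a) (zvec K n).

Definition Hes (K : comNzRingType) (n : nat) (P : {mpoly K[n]}) :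
    'M[{mpoly K[n]}]_n :=
  \matrix_(i < n, j < n) (P^`M(j))^`M(i).

Definition nilpotent_mx (A : comNzRingType) (p : nat) (M : 'M[A]_p) : Prop :=
  exists r : nat, M ^+ r = 0.

Definition hessian_nilpotent (K : comNzRingType) (n : nat)
    (P : {mpoly K[n]}) : Prop :=
  nilpotent_mx (Hes P).

(* Mathcomp's [free] requires a finite-dimensional [vectType], which
   {mpoly K[n]} is not. *)
Definition lin_indep (K : nzRingType) (V : lmodType K) (k : nat)
    (f : 'I_k -> V) : Prop :=
  forall c : 'I_k -> K, \sum_(i < k) c i *: f i = 0 -> forall i, c i = 0.

Definition power_sum (K : comNzRingType) (n k d : nat)
    (alpha : 'I_k -> 'rV[K]_n) : {mpoly K[n]} :=
  \sum_(i < k) hlin (alpha i) ^+ d.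

(* Truncated subtraction in [d - 2]: meaningful for 2 <= d. *)
Definition Psi (K : comNzRingType) (n k d : nat)
    (alpha : 'I_k -> 'rV[K]_n) : 'M[{mpoly K[n]}]_k :=
  \matrix_(i < k, j < k)
    (bform (alpha i) (alpha j) *: hlin (alpha j) ^+ (d - 2)).

(* Main.v *)
(* With A the k x n matrix of rows alpha_i and D = diag (h_i ^ (d-2)), one has
   Hes P = d(d-1) X Y and Psi_P = Y X for X = A^T D and Y = A. Both claims are
   then the general facts that X Y and Y X have powers of equal trace and are
   simultaneously nilpotent. *)
Require Import Defs.
From mathcomp Require Import all_boot all_order all_algebra.
From mathcomp Require Import reals.
From mathcomp Require Import complex mpoly.

Set Implicit Arguments.
Unset Strict Implicit.
Unset Printing Implicit Defensive.

Import GRing.Theory.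
Local Open Scope ring_scope.

(** Reassociating the alternating product [X Y X Y ... X Y] leaves one outer factor at each end,
    ready to be rotated under a trace or annihilated by a zero power inside. *)
Lemma mulmx_exprS (A : comNzRingType) (p q : nat)
    (X : 'M[A]_(p, q)) (Y : 'M[A]_(q, p)) (m : nat) :
  (X *m Y) ^+ m.+1 = X *m (Y *m X) ^+ m *m Y.
Proof.
elim: m => [|m IHm]; first by rewrite expr1 expr0 mulmx1.
by rewrite exprS IHm [(Y *m X) ^+ m.+1]exprS -!mulmxE !mulmxA.
Qed.

(** At exponent 0 the traces are those of identity matrices of sizes [p] and [q], hence the
    positivity condition. *)
Lemma mxtrace_exprC (A : comNzRingType) (p q : nat)
    (X : 'M[A]_(p, q)) (Y : 'M[A]_(q, p)) (m : nat) : (0 < m)%N ->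
  \tr ((X *m Y) ^+ m) = \tr ((Y *m X) ^+ m).
Proof.
case: m => // m _.
by rewrite mulmx_exprS mxtrace_mulC mulmxA exprS -mulmxE.
Qed.

Lemma nilpotent_mulmxC (A : comNzRingType) (p q : nat)
    (X : 'M[A]_(p, q)) (Y : 'M[A]_(q, p)) :
  nilpotent_mx (X *m Y) -> nilpotent_mx (Y *m X).
Proof. by case=> r XYr0; exists r.+1; rewrite mulmx_exprS XYr0 mulmx0 mul0mx. Qed.

Lemma mx_exprZn (A : comNzRingType) (p : nat) (a : A) (M : 'M[A]_p) (m : nat) :
  (a *: M) ^+ m = a ^+ m *: M ^+ m.
Proof.
elim: m => [|m IHm]; first by rewrite !expr0 scale1r.
by rewrite !exprS IHm -!mulmxE -scalemxAl -scalemxAr scalerA.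
Qed.

Lemma mderivXn (K : comNzRingType) (n : nat) (i : 'I_n) (p : {mpoly K[n]})
    (m : nat) :
  (p ^+ m)^`M(i) = (p ^+ m.-1 * p^`M(i)) *+ m.
Proof.
elim: m => [|m IHm]; first by rewrite expr0 mulr0n -mpolyC1 mderivC.
rewrite exprS mderivM IHm /= mulrnAr mulrA mulrC.
(* [p * p ^+ m.-1] equals [p ^+ m] only for positive [m]; at [m = 0] its multiplicity is zero. *)
by case: m {IHm} => [|m]; rewrite ?mulr0n ?addr0 // -exprS -mulrS.
Qed.

Lemma mderiv_hlin (K : comNzRingType) (n : nat) (a : 'rV[K]_n) (i : 'I_n) :
  (hlin a)^`M(i) = (a 0 i)%:MP.
Proof.
rewrite /hlin /bform raddf_sum /= (bigD1 i) //= big1 => [|j jDi].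
  rewrite !mxE mderiv_mulC mderivX mnm1E eqxx scale1r addr0.
  (* Inserting a zero monomial lets the truncated difference [U_(i) - U_(i)] cancel. *)
  by rewrite -[X in (X - _)%MM]add0m addmK mpolyX0 mulr1.
by rewrite !mxE mderiv_mulC mderivX mnm1E (negPf jDi) scale0r mulr0.
Qed.

(** In a domain [a ^+ r] is nonzero, so it cancels from each entry of [a ^+ r *: M ^+ r]. *)
Lemma nilpotent_mxZ (A : idomainType) (p : nat) (a : A) (M : 'M[A]_p) :
  a != 0 -> nilpotent_mx (a *: M) <-> nilpotent_mx M.
Proof.
move=> a_neq0; split=> -[r Mr0]; exists r; last by rewrite mx_exprZn Mr0 scaler0.
apply/matrixP=> i j; move/matrixP/(_ i j)/eqP: Mr0.
by rewrite mx_exprZn !mxE mulf_eq0 expf_eq0 (negPf a_neq0) andbF => /eqP.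
Qed.

Section Factorization.

Variables (K : comNzRingType) (n d k : nat) (alpha : 'I_k -> 'rV[K]_n).

Definition coef_mx : 'M[{mpoly K[n]}]_(k, n) :=
  \matrix_(i, a) (alpha i 0 a)%:MP.

Definition weight_mx : 'M[{mpoly K[n]}]_k :=
  diag_mx (\row_i hlin (alpha i) ^+ (d - 2)).

(** Regrouped, this is the Gram matrix of the [alpha i] with column [j] scaled by the [j]-th
    weight. *)
Lemma Psi_factor : Psi d alpha = coef_mx *m (coef_mx^T *m weight_mx).
Proof.
rewrite mulmxA; apply/matrixP=> i j; rewrite mul_mx_diag !mxE -mul_mpolyC.
by congr (_ * _); rewrite raddf_sum; apply: eq_bigr => a _; rewrite !mxE /= mpolyCM.
Qed.

Lemma Hes_power_sum_factor :
  Hes (power_sum d alpha) =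
  (d * (d - 1))%:R *: ((coef_mx^T *m weight_mx) *m coef_mx).
Proof.
apply/matrixP=> a b; rewrite mul_mx_diag !mxE /power_sum (raddf_sum (mderiv b)) (raddf_sum (mderiv a)) mulr_sumr /=.
apply: eq_bigr => i _.
(* The first derivatives of a linear form are constants, so only the power is differentiated
   again. *)
rewrite !mxE mderivXn mderiv_hlin mderivMn mderivM mderivC mulr0 addr0.
rewrite mderivXn mderiv_hlin -!subn1 -subnDA mulr_natl mulrnAl -mulrnA mulnC.
by rewrite [(alpha i 0 a)%:MP * _]mulrC.
Qed.

End Factorization.

Theorem proposition5p3 (R : realType) (n d k : nat)
    (alpha : 'I_k -> 'rV[R[i]]_n)
    (hd : (2 <= d)%N) (hk : (1 <= k)%N)
    (hiso : forall i : 'I_k, bform (alpha i) (alpha i) = 0)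
    (hindep : lin_indep (fun i : 'I_k => hlin (alpha i) ^+ d)) :
  (forall m : nat, (1 <= m)%N ->
     \tr (Hes (power_sum d alpha) ^+ m) =
     ((d * (d - 1))%:R ^+ m : R[i]) *: \tr (Psi d alpha ^+ m)) /\
  (hessian_nilpotent (power_sum d alpha) <-> nilpotent_mx (Psi d alpha)).
Proof.
rewrite /hessian_nilpotent Hes_power_sum_factor Psi_factor; split=> [m m_gt0|].
  rewrite mx_exprZn mxtraceZ mxtrace_exprC // -mul_mpolyC.
  (* The complex scalar of the statement and the polynomial scalar of the factorization agree
     through the embedding of constants. *)
  by rewrite rmorphXn /= rmorph_nat.
(* Characteristic zero and [2 <= d] enter here. *)
have c_neq0 : (d * (d - 1))%:R != 0 :> {mpoly R[i][n]}.
  rewrite -(rmorph_nat (@mpolyC n R[i])) mpolyC_eq0 Num.Theory.pnatr_eq0 -lt0n.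
  by rewrite muln_gt0 subn_gt0 hd (ltnW hd).
by rewrite (nilpotent_mxZ _ c_neq0); split; apply: nilpotent_mulmxC.
Qed.
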